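(* Let $\langle X,\tau^0,\tau^1\rangle$ be any bitopological space. The following are equivalent: (1) $\langle X,\tau^0\rangle$ is scattered and both $\tau^0$ and $\tau^1$ are Alexandroff; (2) there exists a Visser frame $\langle X,R,S\rangle$ such that $\tau^0=\tau_R$ and $\tau^1=\tau_S$.
   Context: A bitopological space is $\langle X,\tau^0,\tau^1\rangle$ with $X\neq\varnothing$ and $\tau^0,\tau^1$ topologies on $X$. For a topology $\tau$, $d_\tau(Y)=\{x: \text{every } U\in\tau \text{ containing } x \text{ meets } Y\setminus\{x\}\}$; $\langle X,\tau\rangle$ is scattered if $Y\setminus d_\tau(Y)\ne\varnothing$ for every nonempty $Y\subseteq X$; $\tau$ is Alexandroff if it is closed under arbitrary intersections. A Visser frame is $\langle W,R,S\rangle$ with $W\neq\varnothing$, $R$ a transitive and conversely well-founded binary relation on $W$ (no infinite sequence $x_0Rx_1Rx_2\cdots$), and $S$ a transitive reflexive binary relation on $W$. For a binary relation $P$ on $W$, $\tau_P$ is the family of $P$-upward closed subsets of $W$ (sets $Y$ with $x\in Y$, $xPy\Rightarrow y\in Y$). *)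

(* Defs.v *)
From Corelib Require Import RelationClasses.
From mathcomp Require Import all_boot.
From mathcomp Require Import boolp classical_sets.

Set Implicit Arguments.
Unset Strict Implicit.
Unset Printing Implicit Defensive.

Local Open Scope classical_set_scope.

(* Topologies are families of open sets rather than [topologicalType]
   structures, since a bitopological space carries two of them on the same type
   and they are compared by equality with families of up-closed sets. *)
Record is_topology (X : Type) (tau : set (set X)) : Prop := IsTopology {
  topology_set0 : tau set0;
  topology_setT : tau setT;
  topology_setI : setI_closed tau;
  topology_bigcup : forall F : set (set X), F `<=` tau -> tau (\bigcup_(U in F) U)
}.

Record bitopological_space (X : Type) (tau0 tau1 : set (set X)) : Prop :=
  BitopologicalSpace {
    bitopological_nonempty : [set: X] !=set0;
    bitopological_topology0 : is_topology tau0;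
    bitopological_topology1 : is_topology tau1
  }.

Definition derived_set (X : Type) (tau : set (set X)) (Y : set X) : set X :=
  [set x | forall U : set X, tau U -> U x -> U `&` (Y `\ x) !=set0].

Definition scattered (X : Type) (tau : set (set X)) : Prop :=
  forall Y : set X, Y !=set0 -> Y `\` derived_set tau Y !=set0.

(* [F] may be empty, its intersection then being the whole space. *)
Definition alexandroff (X : Type) (tau : set (set X)) : Prop :=
  forall F : set (set X), F `<=` tau -> tau (\bigcap_(U in F) U).

Definition conversely_well_founded (W : Type) (R : W -> W -> Prop) : Prop :=
  ~ exists x : nat -> W, forall n : nat, R (x n) (x n.+1).

Record visser_frame (W : Type) (R S : W -> W -> Prop) : Prop := VisserFrame {
  visser_nonempty : [set: W] !=set0;
  visser_R_trans : Transitive R;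
  visser_R_cwf : conversely_well_founded R;
  visser_S_trans : Transitive S;
  visser_S_refl : Reflexive S
}.

Definition upset_topology (W : Type) (P : W -> W -> Prop) : set (set W) :=
  [set Y | forall x y : W, Y x -> P x y -> Y y].

(* Main.v *)
Require Import Defs.
From mathcomp Require Import all_boot.
From mathcomp Require Import boolp classical_sets.

(** Alexandroff topologies are exactly the families of up-sets of their
    specialization preorders. In the scattered case the irreflexive part of the
    preorder has the same up-sets; it admits no infinite ascending chain, since
    the range of such a chain would have no isolated point, and it is therefore
    also transitive, as a 2-cycle would yield an infinite chain. Conversely, a
    nonempty set that is contained in its derived set contains an infinite
    chain, because the least open neighbourhood of [y] is [y] with its
    successors. *)

Local Open Scope classical_set_scope.

(** Oriented so that open sets are closed upwards: [x] lies in the closure of the singleton of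
    [y]. *)
Definition specialization {X : Type} (tau : set (set X)) (x y : X) : Prop :=
  forall U : set X, tau U -> U x -> U y.

Definition strict_specialization {X : Type} (tau : set (set X)) (x y : X) :
  Prop := x <> y /\ specialization tau x y.

Lemma upset_strict_specialization {X : Type} (tau : set (set X)) :
  upset_topology (strict_specialization tau) =
  upset_topology (specialization tau).
Proof.
apply/seteqP; split=> Y upY x y Yx; last by case=> _; exact: upY.
by have [<-//|neq_xy xy] := pselect (x = y); apply: upY Yx _.
Qed.

Lemma alexandroff_upset {X : Type} (tau : set (set X)) :
  is_topology tau -> alexandroff tau ->
  tau = upset_topology (specialization tau).
Proof.
move=> topX alex; apply/seteqP; split=> Y; first by move=> tauY x y Yx; apply.
move=> upY.
(* [N x] is the least open neighbourhood of [x], open because [tau] is Alexandroff. An up-set is the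
   union of the [N x] over its points. *)
pose N x : set X := \bigcap_(U in [set U | tau U /\ U x]) U.
have -> : Y = \bigcup_(V in [set N x | x in Y]) V.
  apply/seteqP; split=> [x Yx|y [_ [x Yx <-] Nxy]].
    by exists (N x); [exists x | move=> U []].
  by apply: (upY x) => // U tauU Ux; apply: Nxy.
apply: topology_bigcup topX _ _ => _ [x _ <-].
by apply: alex => U [].
Qed.

Lemma scattered_cwf {X : Type} (tau : set (set X)) :
  scattered tau -> conversely_well_founded (strict_specialization tau).
Proof.
move=> scat [x chain].
have [|_ [[n _ <-]]] := scat (range x); first by exists (x 0), 0.
(* The supposed isolated point is some [x n], but every open set around it also contains
   [x n.+1]. *)
apply=> U tauU Ux; have [neq_x spec_x] := chain n.
exists (x n.+1); split; first exact: spec_x.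
by split; [exists n.+1 | move=> /esym].
Qed.

Lemma cwf_asym {X : Type} (R : X -> X -> Prop) (x y : X) :
  conversely_well_founded R -> R x y -> ~ R y x.
Proof.
move=> cwf Rxy Ryx; apply: cwf; exists (fun n => if odd n then y else x) => n.
by rewrite /=; case: (odd n).
Qed.

Lemma scattered_strict_specialization_trans {X : Type} (tau : set (set X)) :
  scattered tau -> RelationClasses.Transitive (strict_specialization tau).
Proof.
move=> /scattered_cwf cwf x y z Rxy Ryz; split.
  by move=> eq_xz; subst z; exact: cwf_asym cwf Rxy Ryz.
by move=> U tauU Ux; apply: (proj2 Ryz) => //; apply: (proj2 Rxy).
Qed.

Lemma upset_alexandroff {X : Type} (P : X -> X -> Prop) :
  alexandroff (upset_topology P).
Proof.
by move=> F sFP x y Fx Pxy U FU; apply: sFP Pxy => //; exact: Fx.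
Qed.

(** Dependent choice: a successor function chosen on the subtype of [Y] is iterated, so that the
    chain never leaves [Y]. *)
Lemma serial_on_not_cwf {X : Type} (R : X -> X -> Prop) (Y : set X) :
  Y !=set0 -> (forall y, Y y -> exists2 z, Y z & R y z) ->
  ~ conversely_well_founded R.
Proof.
move=> [y0 Yy0] serial; apply.
have /choice [f fP] (y : {y | Y y}) : exists z : {z | Y z}, R (sval y) (sval z).
  by have [z Yz Ryz] := serial _ (svalP y); exists (exist _ z Yz).
by exists (fun n => sval (iter n f (exist _ y0 Yy0))) => n; exact: fP.
Qed.

Lemma cwf_scattered {X : Type} (R : X -> X -> Prop) :
  RelationClasses.Transitive R -> conversely_well_founded R ->
  scattered (upset_topology R).
Proof.
move=> trR cwf Y Y0; apply: contrapT => /nonemptyPn perfectY.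
apply: (serial_on_not_cwf R Y) cwf => // y Yy.
have : derived_set (upset_topology R) Y y.
  by apply: contrapT => isoy; have : (Y `\` derived_set (upset_topology R) Y) y;
    [split | rewrite perfectY].
(* This set is open by transitivity; a point of [Y] in it other than [y] is the required
   successor. *)
case/(_ [set z | y = z \/ R y z]); [|by left|].
  by move=> a b [<-|Rya] Rab; right; [|exact: trR Rab].
by move=> z [[eq_yz|Ryz] [Yz neq_zy]]; [case: neq_zy | exists z].
Qed.

Theorem theorem3p8 (X : Type) (tau0 tau1 : set (set X))
    (bitop : bitopological_space tau0 tau1) :
  (scattered tau0 /\ alexandroff tau0 /\ alexandroff tau1) <->
  (exists R S : X -> X -> Prop,
     visser_frame R S /\ tau0 = upset_topology R /\ tau1 = upset_topology S).
Proof.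
case: bitop => X0 top0 top1; split=> [[scat [alex0 alex1]]|].
  exists (strict_specialization tau0), (specialization tau1); split.
    split=> //; [exact: scattered_strict_specialization_trans
                |exact: scattered_cwf | |by move=> x U].
    by move=> x y z xy yz U tauU Ux; apply: yz => //; apply: xy.
  by rewrite upset_strict_specialization; split; apply: alexandroff_upset.
case=> R [S [[_ trR cwf _ _] [-> ->]]]; split; first exact: cwf_scattered.
by split; exact: upset_alexandroff.
Qed.
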